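(* Let $P, F \subseteq \mathbb{R}^n$ be convex polyhedra, let $(V_P, C_P, R_P)$ be a generator for $P$ and let $(V_F, C_F, R_F)$ be a generator for $F$. Then the triple $$\big(V_P \oplus V_F,\; C_P \cup V_P,\; R_P \cup V_F \cup C_F \cup R_F\big)$$ is a generator for the positive post-flow of $P$ with respect to $F$, i.e., for the set $$\{\, x + \delta \cdot y \mid x \in P,\ y \in F,\ \delta > 0 \,\},$$ where $\oplus$ denotes Minkowski sum, i.e., $V_P \oplus V_F = \{ v_1 + v_2 \mid v_1 \in V_P,\ v_2 \in V_F \}$.
   Context: A convex polyhedron is a subset of $\mathbb{R}^n$ that is the intersection of a finite number of half-spaces; half-spaces may be open or closed, so convex polyhedra are not necessarily topologically closed. Generator: a triple $(V, C, R)$ of finite subsets of $\mathbb{R}^n$ (whose elements are called points, closure points and rays, respectively) is a generator for a set $S \subseteq \mathbb{R}^n$ if, for all $x \in \mathbb{R}^n$, $x \in S$ if and only if $x$ can be written as $$x = \sum_{v \in V} \alpha_v \cdot v + \sum_{c \in C} \beta_c \cdot c + \sum_{r \in R} \gamma_r \cdot r,$$ where all coefficients $\alpha_v$, $\beta_c$, $\gamma_r$ are non-negative reals, $\sum_{v \in V} \alpha_v + \sum_{c \in C} \beta_c = 1$, and there exists $v \in V$ such that $\alpha_v > 0$. It is a known fact that every convex polyhedron in $\mathbb{R}^n$ has a generator. *)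

(* Defs.v *)
From HB Require Import structures.
From mathcomp Require Import all_boot all_order all_algebra.
From mathcomp Require Import finmap.
From mathcomp Require Import classical_sets cardinality reals.

Set Implicit Arguments.
Unset Strict Implicit.
Unset Printing Implicit Defensive.

Import Order.TTheory GRing.Theory Num.Theory.

Local Open Scope classical_set_scope.
Local Open Scope ring_scope.

Section Polyhedra.
Variables (R : realType) (n : nat).
Local Notation Rn := 'rV[R]_n.

Definition dot (a x : Rn) : R := \sum_(i < n) a 0 i * x 0 i.

Definition is_halfspace (H : set Rn) : Prop :=
  exists (a : Rn) (b : R), a <> 0 /\
    (H = [set x | b <= dot a x] \/ H = [set x | b < dot a x]).

(* The empty intersection is the whole space. *)
Definition is_convex_polyhedron (P : set Rn) : Prop :=
  exists HH : set (set Rn),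
    [/\ finite_set HH, HH `<=` is_halfspace & P = \bigcap_(H in HH) H].

(* [V], [C], [D] are the points, closure points and rays.  They may overlap,
   and only the values of the coefficient functions on these sets matter. *)
Definition is_generator (V C D : {fset Rn}) (S : set Rn) : Prop :=
  forall x : Rn, S x <->
    exists alpha beta gamma : Rn -> R,
      [/\ [/\ forall v, v \in V -> 0 <= alpha v,
              forall c, c \in C -> 0 <= beta c &
              forall r, r \in D -> 0 <= gamma r],
          \sum_(v <- V) alpha v + \sum_(c <- C) beta c = 1,
          exists2 v, v \in V & 0 < alpha v &
          x = \sum_(v <- V) alpha v *: v + \sum_(c <- C) beta c *: c
              + \sum_(r <- D) gamma r *: r].

Definition minkowski_sum (A B : {fset Rn}) : {fset Rn} :=
  [fset (v1 + v2)%R | v1 in A, v2 in B]%fset.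

Definition positive_post_flow (P F : set Rn) : set Rn :=
  [set z | exists (x y : Rn) (delta : R),
     [/\ P x, F y, 0 < delta & z = x + delta *: y]].

End Polyhedra.

(* Main.v *)
(** The coefficient functions in a generator only matter through the total
    weight and the value of the three nonnegative combinations they define, and
    pairs (weight, value) form a convex cone.  If [x] puts weight on [v] in [VP]
    and [delta *: y] puts weight on [w] in [VF], a small common amount of both
    can be moved to the single point [v + w]; what is left over is absorbed by
    the closure points and the rays.  Conversely, splitting each [v + w] yields a
    point of [P] plus a conic combination of the generators of [F], whose weight
    on [VF] and [CF] is the required [delta]. *)
Require Import Defs.
From HB Require Import structures.
From mathcomp Require Import all_boot all_order all_algebra.
From mathcomp Require Import finmap.
From mathcomp Require Import classical_sets cardinality reals.
From mathcomp Require Import lra.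

Set Implicit Arguments.
Unset Strict Implicit.
Unset Printing Implicit Defensive.

Import Order.TTheory GRing.Theory Num.Theory.

Local Open Scope ring_scope.

Section Conic.
Variables (R : realType) (n : nat).
Local Notation Rn := 'rV[R]_n.
Implicit Types (A B C D V : {fset Rn}) (s t : R) (x y v : Rn).

Definition conic A s x : Prop :=
  exists f : Rn -> R, [/\ forall v, v \in A -> 0 <= f v,
    \sum_(v <- A) f v = s & \sum_(v <- A) f v *: v = x].

Lemma conic0 A : conic A 0 0.
Proof.
exists (fun=> 0); split=> //; first by rewrite big1.
by rewrite big1 // => v _; rewrite scale0r.
Qed.

Lemma conicD A s t x y : conic A s x -> conic A t y -> conic A (s + t) (x + y).
Proof.
move=> [f [f0 <- <-]] [g [g0 <- <-]]; exists (fun v => f v + g v); split.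
- by move=> v vA; rewrite addr_ge0 ?f0 ?g0.
- by rewrite big_split.
- by rewrite -big_split; apply: eq_bigr => v _; rewrite scalerDl.
Qed.

Lemma conicZ A s t x : 0 <= t -> conic A s x -> conic A (t * s) (t *: x).
Proof.
move=> t0 [f [f0 <- <-]]; exists (fun v => t * f v); split.
- by move=> v vA; rewrite mulr_ge0 ?f0.
- by rewrite mulr_sumr.
- by rewrite scaler_sumr; apply: eq_bigr => v _; rewrite scalerA.
Qed.

Lemma sum_fset_pred1 (M : nmodType) A v (F : Rn -> M) : v \in A ->
  (forall u, u != v -> F u = 0) -> \sum_(u <- A) F u = F v.
Proof.
move=> vA F0; rewrite (big_rem v) //= big1_seq ?addr0 // => u /andP[_].
by rewrite mem_rem_uniq ?fset_uniq // inE => /andP[/F0].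
Qed.

Lemma conic1 A t v : v \in A -> 0 <= t -> conic A t (t *: v).
Proof.
move=> vA t0; exists (fun u => if u == v then t else 0); split.
- by move=> u _; case: ifP.
- by rewrite (sum_fset_pred1 vA) ?eqxx // => u /negPf->.
- by rewrite (sum_fset_pred1 vA) ?eqxx // => u /negPf->; rewrite scale0r.
Qed.

(** A finite sum is built by adding its terms one at a time, so a property closed under addition
    need only be checked on single scaled generators. Inclusions and splittings of combinations thus
    never manipulate coefficient functions. *)
Lemma conic_ind A (K : R -> Rn -> Prop) : K 0 0 ->
  (forall s t x y, K s x -> K t y -> K (s + t) (x + y)) ->
  (forall t v, v \in A -> 0 <= t -> K t (t *: v)) ->
  forall s x, conic A s x -> K s x.
Proof.
move=> K0 KD K1 _ _ [f [f0 <- <-]]; rewrite !big_seq.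
apply: (big_ind2 K) => // [s x t y|v vA]; first exact: KD.
by apply: K1; rewrite ?f0.
Qed.

Lemma conic_ge0 A s x : conic A s x -> 0 <= s.
Proof. by move=> [f [f0 <- _]]; rewrite big_seq sumr_ge0. Qed.

Lemma conicS A B s x : {subset A <= B} -> conic A s x -> conic B s x.
Proof.
move=> AB; apply: (conic_ind (K := conic B)); first exact: conic0.
  by move=> *; apply: conicD.
by move=> t v /AB; apply: conic1.
Qed.

(** The sets may overlap: each generator's term goes whole to one set containing it. *)
Lemma conicU A B s x : conic (A `|` B)%fset s x ->
  exists s1 s2 x1 x2,
    [/\ conic A s1 x1, conic B s2 x2, s = s1 + s2 & x = x1 + x2].
Proof.
move: s x; apply: conic_ind.
- by exists 0, 0, 0, 0; rewrite !addr0; split=> //; apply: conic0.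
- move=> _ _ _ _ [s1 [s2 [x1 [x2 [? ? -> ->]]]]] [t1 [t2 [y1 [y2 [? ? -> ->]]]]].
  exists (s1 + t1), (s2 + t2), (x1 + y1), (x2 + y2).
  by split; [apply: conicD| apply: conicD| rewrite addrACA| rewrite addrACA].
- move=> t v; rewrite inE => /orP[] vAB t0.
    exists t, 0, (t *: v), 0.
    by rewrite !addr0; split=> //; [apply: conic1|apply: conic0].
  exists 0, t, 0, (t *: v).
  by rewrite !add0r; split=> //; [apply: conic0|apply: conic1].
Qed.

(** Splitting [t *: (v + w)] gives [t *: v] and [t *: w], so both halves keep the full weight
    instead of sharing it. *)
Lemma conic_minkowski A B s x : conic (minkowski_sum A B) s x ->
  exists x1 x2, [/\ conic A s x1, conic B s x2 & x = x1 + x2].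
Proof.
move: s x; apply: conic_ind.
- by exists 0, 0; rewrite addr0; split=> //; apply: conic0.
- move=> s t _ _ [x1 [x2 [? ? ->]]] [y1 [y2 [? ? ->]]].
  exists (x1 + y1), (x2 + y2).
  by split; [apply: conicD| apply: conicD| rewrite addrACA].
- move=> t _ /imfset2P[v vA [w wB ->]] t0.
  by exists (t *: v), (t *: w); rewrite scalerDr; split=> //; apply: conic1.
Qed.

(** A positive sum has a positive coefficient, which serves as [c]. Allowing every [e <= c] lets two
    combinations give up the same amount. *)
Lemma conic_gt0 A s x : conic A s x -> 0 < s ->
  exists v c, [/\ v \in A, 0 < c &
    forall e, e <= c -> conic A (s - e) (x - e *: v)].
Proof.
move=> [f [f0 <- <-]] s_gt0.
have [/hasP[v /= vA fv]|/hasPn/= fN] := boolP (has (fun v => 0 < f v) A); last first.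
  have : \sum_(v <- A) f v <= 0.
    by rewrite big_seq sumr_le0 // => v /fN; rewrite -leNgt.
  by rewrite leNgt s_gt0.
exists v, (f v); split=> // e e_le.
exists (fun u => f u - (if u == v then e else 0)); split.
- move=> u uA; case: eqP => [->|_]; first by rewrite subr_ge0.
  by rewrite subr0 f0.
- rewrite sumrB; congr (_ - _).
  by rewrite (sum_fset_pred1 vA) ?eqxx // => u /negPf->.
- rewrite /=; under eq_bigr do rewrite scalerBl.
  rewrite sumrB; congr (_ - _).
  by rewrite (sum_fset_pred1 vA) ?eqxx // => u /negPf->; rewrite scale0r.
Qed.

(** With nonnegative coefficients, some point has a positive one exactly when the total weight [a]
    on [V] is positive. The weight [t] of the rays is left free. *)
Definition generated V C D x : Prop :=
  exists a b t p q r, [/\ [/\ conic V a p, conic C b q & conic D t r],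
    0 < a, a + b = 1 & x = p + q + r].

Lemma generatedP V C D x :
  generated V C D x <->
  exists alpha beta gamma : Rn -> R,
      [/\ [/\ forall v, v \in V -> 0 <= alpha v,
              forall c, c \in C -> 0 <= beta c &
              forall r, r \in D -> 0 <= gamma r],
          \sum_(v <- V) alpha v + \sum_(c <- C) beta c = 1,
          exists2 v, v \in V & 0 < alpha v &
          x = \sum_(v <- V) alpha v *: v + \sum_(c <- C) beta c *: c
              + \sum_(r <- D) gamma r *: r].
Proof.
split.
  move=> [a [b [t [p [q [r [[Vp Cq Dr] a_gt0 ab ->]]]]]]].
  move: Vp Cq Dr a_gt0 ab => [f [f0 <- <-]] [g [g0 <- <-]] [h [h0 _ <-]] f_gt0 fg.
  exists f, g, h; split=> //.
  have : \sum_(v <- V) f v != 0 by rewrite gt_eqF.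
  rewrite big_seq psumr_neq0 // => /hasP[v _ /andP[vV fv]].
  by exists v.
move=> [f [g [h [[f0 g0 h0] fg [v vV fv] ->]]]].
exists (\sum_(v <- V) f v), (\sum_(c <- C) g c), (\sum_(r <- D) h r).
exists (\sum_(v <- V) f v *: v), (\sum_(c <- C) g c *: c).
exists (\sum_(r <- D) h r *: r); split=> //.
  by split; [exists f|exists g|exists h].
rewrite (big_rem v) //= ltr_pwDl // big_seq sumr_ge0 // => u /mem_rem.
exact: f0.
Qed.

Lemma is_generatorE V C D (S : set Rn) :
  is_generator V C D S <-> forall x, S x <-> generated V C D x.
Proof.
by split=> SE x; split=> [/SE/generatedP//|/generatedP/SE].
Qed.

End Conic.

Theorem theorem2 (R : realType) (n : nat)
  (P F : set 'rV[R]_n) (VP CP RP VF CF RF : {fset 'rV[R]_n}) :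
  is_convex_polyhedron P ->
  is_convex_polyhedron F ->
  is_generator VP CP RP P ->
  is_generator VF CF RF F ->
  is_generator (minkowski_sum VP VF)
               (CP `|` VP)%fset
               (RP `|` VF `|` CF `|` RF)%fset
               (positive_post_flow P F).
Proof.
move=> _ _ /is_generatorE PE /is_generatorE FE; apply/is_generatorE => z; split.
  move=> [x [y [d [/PE Px /FE Fy d_gt0 ->]]]].
  have d_ge0 := ltW d_gt0.
  move: Px => [a [b [t [p [q [r [[VPp CPq RPr] a_gt0 ab ->]]]]]]].
  move: Fy => [a' [b' [t' [p' [q' [r' [[VFp CFq RFr] a'_gt0 _ ->]]]]]]].
  have [v [c [vP c_gt0 VPv]]] := conic_gt0 VPp a_gt0.
  have [w [c' [wF c'_gt0 VFw]]] :=
    conic_gt0 (conicZ d_ge0 VFp) (mulr_gt0 d_gt0 a'_gt0).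
  (* The largest amount that can safely be taken from both [v] and [w]. *)
  pose e := Num.min c c'.
  have e_gt0 : 0 < e by rewrite lt_min c_gt0.
  have ec : e <= c by rewrite ge_min lexx.
  have ec' : e <= c' by rewrite ge_min lexx orbT.
  (* The remainder of the [VP] part becomes closure points, so the affine weight is still [a + b].
     The remainder of [d *: y] becomes rays. *)
  exists e, (b + (a - e)), (t + (d * a' - e) + d * b' + d * t').
  exists (e *: (v + w)), (q + (p - e *: v)).
  exists (r + (d *: p' - e *: w) + d *: q' + d *: r').
  split=> //; first split.
  - apply: conic1; last exact: ltW.
    exact: in_imfset2.
  - apply: conicD; [move: CPq|move: (VPv _ ec)]; apply: conicS => u uA.
      by rewrite inE uA.
    by rewrite inE uA orbT.
  - apply: conicD; [apply: conicD; [apply: conicD|]|].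
    + by move: RPr; apply: conicS => u uA; rewrite !inE uA.
    + by move: (VFw _ ec'); apply: conicS => u uA; rewrite !inE uA ?orbT.
    + by move: (conicZ d_ge0 CFq); apply: conicS => u uA; rewrite !inE uA ?orbT.
    + by move: (conicZ d_ge0 RFr); apply: conicS => u uA; rewrite !inE uA ?orbT.
  - by lra.
  - by apply/rowP => i; rewrite !mxE; lra.
move=> [a [b [t [p [q [r [[/conic_minkowski Vp /conicU Cq Dr] a_gt0 ab ->]]]]]]].
move: Vp => [p1 [p2 [VPp VFp ->]]].
move: Cq ab => [b1 [b2 [q1 [q2 [CPq VPq -> ->]]]]] ab.
(* The union associates to the left, so the ray sets are peeled off from the right. *)
move: Dr => /conicU[t123 [t4 [r123 [r4 [/conicU Dr RFr _ ->]]]]].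
move: Dr => [t12 [t3 [r12 [r3 [/conicU Dr CFr _ ->]]]]].
move: Dr => [t1 [t2 [r1 [r2 [RPr VFr _ ->]]]]].
have b2_ge0 := conic_ge0 VPq.
have t2_ge0 := conic_ge0 VFr.
have t3_ge0 := conic_ge0 CFr.
(* The weight on [VF] is [a] from [p2] plus [t2] from [r2], and [r3] puts [t3] on [CF]. Division by
   [d] normalises the total to 1, and [a > 0] keeps the share of [VF] positive. *)
pose d := a + t2 + t3.
have d_gt0 : 0 < d by rewrite /d; lra.
have dV_ge0 : 0 <= d^-1 by rewrite invr_ge0 ltW.
(* The points of [VP] come both from the Minkowski sum ([p1]) and from the closure points ([q2]),
   with total weight [a + b2]. *)
exists ((p1 + q2) + q1 + r1), (d^-1 *: (p2 + r2) + d^-1 *: r3 + d^-1 *: r4), d.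
split=> //.
- apply/PE; exists (a + b2), b1, t1, (p1 + q2), q1, r1; split=> //; try lra.
  by split=> //; apply: conicD.
- apply/FE; exists (d^-1 * (a + t2)), (d^-1 * t3), (d^-1 * t4).
  exists (d^-1 *: (p2 + r2)), (d^-1 *: r3), (d^-1 *: r4); split=> //.
  + by split; apply: conicZ => //; apply: conicD.
  + by rewrite mulr_gt0 ?invr_gt0 //; lra.
  + by rewrite -mulrDr mulVf ?gt_eqF.
- rewrite -!scalerDr scalerA divff ?gt_eqF // scale1r.
  by apply/rowP => i; rewrite !mxE; lra.
Qed.
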